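(* **(Construction of real quadratic cyclic sequences.)** Let $q(x)=a_{n-2}x^{n-2}+a_{n-3}x^{n-3}+\cdots+a_1x+a_0$ ($n\ge 2$) be any polynomial with integer coefficients all strictly positive. Multiply by $x+1$ to obtain the new polynomial $$p(x):=b_{n-1}x^{n-1}+b_{n-2}x^{n-2}+\cdots+b_1x+b_0 = a_{n-2}x^{n-1}+(a_{n-2}+a_{n-3})x^{n-2}+\cdots+(a_1+a_0)x+a_0 .$$ Let $y$ be any real root of $p(x)$ (necessarily negative). Then a quadratic cyclic sequence $(x_0,x_1,x_2,\ldots,x_{N-1})$ of order $N=2\sum_k a_k$ is constructed by arbitrarily prescribing $x_0$ and then requiring the increments $u_j=x_{j+1}-x_j$ of successive terms to be taken from the set $\{1,y,y^2,\ldots,y^{n-1}\}$ in such a way that each increment $y^k$ occurs precisely $b_k$ times and any two adjacent increments have powers that differ by precisely one. This is always possible and, up to these constraints, the ordering is arbitrary. The constant $\gamma$ of the sequence is given by $\gamma=2(1+y^2)/(1-y)^2<2$. **(Converse.)** Conversely, up to addition of a constant, cyclic permutations and order reversal, a multiple of any non-constant real quadratic cyclic sequence with $\gamma\neq 2$ arises in this way from such a polynomial $p(x)$, well-defined up to replacement of $p(x)$ by $\widetilde p(x):=x^{\deg p}p(1/x)$. **(Special values.)** The cyclic sequences with $\gamma=2$ are characterized as those made up of connected segments of order $\geq 2$ on which the sequence is constant. The cyclic sequences with $\gamma=1$ are, up to normalization, equivalent to $(0,1,0,1,\ldots,0,1)$; they arise by taking the root $y=-1$ of $p(x)$.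
   Context: For an integer $N\ge 2$, a *quadratic cyclic sequence (QCS) of order $N$* is a function $\phi:\mathbb{Z}/N\mathbb{Z}\to\mathbb{C}$, written $(x_0,\ldots,x_{N-1})$ with $x_j=\phi(j)$, such that for some real number $\gamma$ $$\frac{\gamma}{2}\big(2\phi(j)-\phi(j-1)-\phi(j+1)\big)^2=\big(\phi(j)-\phi(j-1)\big)^2+\big(\phi(j)-\phi(j+1)\big)^2\qquad\text{for all } j\in\mathbb{Z}/N\mathbb{Z},$$ with indices $j\pm1$ taken modulo $N$. This equation is invariant (for fixed $\gamma$) under *normalizations* $\phi\mapsto a\phi+b$ ($a,b\in\mathbb{C}$, $a\neq0$) and $\phi\mapsto\overline{\phi}$, and under cyclic permutations and order reversal of $(\phi(0),\ldots,\phi(N-1))$. A QCS is *real* if every term is real under some normalization. The increments $u_j$ are indexed cyclically (by $\mathbb{Z}/N\mathbb{Z}$).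
   Formalization: At γ=1 uniqueness of p up to p~ fails as stated ((0,1,0,1) arises with y=-1 from 2x+2 and x^2+2x+1), so there it is claimed only among p, y with 1, y, ..., y^(n-1) distinct; the description of the sequences with γ=1 excludes constant sequences. *)

(* Defs.v *)
(* The complex numbers are R[i], over an arbitrary R : realType. *)
From mathcomp Require Export all_boot all_order all_algebra.
From mathcomp Require Export complex.
From mathcomp Require Export reals.

Set Implicit Arguments.
Unset Strict Implicit.
Unset Printing Implicit Defensive.

Import Order.TTheory GRing.Theory Num.Theory.
Local Open Scope ring_scope.
Local Open Scope complex_scope.

(* Z/NZ is rendered by 'Z_N, which is the right ring only for 1 < N; N >= 2 is
   not built into the definitions below and has to be assumed where they are
   used. *)

Definition qcs_eq (R : realType) (N : nat) (gamma : R) (phi : 'Z_N -> R[i]) :=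
  forall j : 'Z_N,
    (gamma / 2)%:C * (2 * phi j - phi (j - 1) - phi (j + 1)) ^+ 2
    = (phi j - phi (j - 1)) ^+ 2 + (phi j - phi (j + 1)) ^+ 2.

Definition nonconstant (R : realType) (N : nat) (phi : 'Z_N -> R[i]) :=
  exists i j : 'Z_N, phi i <> phi j.

(* Compositions of the maps phi |-> a phi + b (a != 0) and phi |-> phi^* are
   exactly the maps phi |-> a phi + b and phi |-> a phi^* + b. *)
Definition normalizes_to (R : realType) (N : nat) (phi psi : 'Z_N -> R[i]) :=
  exists a b : R[i], a != 0 /\
    ((forall j, psi j = a * phi j + b) \/
     (forall j, psi j = a * conjc (phi j) + b)).

Definition real_seq (R : realType) (N : nat) (phi : 'Z_N -> R[i]) :=
  exists2 psi : 'Z_N -> R[i],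
    normalizes_to phi psi & forall j, psi j \is Num.real.

(* q = a_{n-2} x^{n-2} + ... + a_0, with a_k = q`_k. *)
Definition positive_coefs (n : nat) (q : {poly int}) :=
  size q = n.-1 /\ forall k, (k < n.-1)%N -> 0 < q`_k.

Definition qcs_order (n : nat) (q : {poly int}) : int :=
  2 * \sum_(k < n.-1) q`_k.

Definition qcs_poly (q : {poly int}) : {poly int} := ('X + 1) * q.

(* x^(deg p) p(1/x) *)
Definition recip_poly (p : {poly int}) : {poly int} :=
  \sum_(k < size p) p`_k *: 'X^((size p).-1 - k).

(* The constraints on the exponents e j of the increments u_j = y^(e j), with
   b_k = (qcs_poly q)`_k. Occurrences are counted on exponents, not on the
   values y^k: when y = -1 these values are not distinct. *)
Definition allowed_exponents (n N : nat) (q : {poly int})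
    (e : 'Z_N -> 'I_n) :=
  (forall k : 'I_n, #|[set j | e j == k]|%:Z = (qcs_poly q)`_k) /\
  (forall j : 'Z_N, (e (j + 1)%R = (e j).+1 :> nat) \/
                    (e j = (e (j + 1)%R).+1 :> nat)).

Definition increments (R : realType) (n N : nat) (y : R) (e : 'Z_N -> 'I_n)
    (phi : 'Z_N -> R[i]) :=
  forall j : 'Z_N, phi (j + 1) - phi j = (y ^+ e j)%:C.

Definition arises (R : realType) (n N : nat) (q : {poly int}) (y : R)
    (phi : 'Z_N -> R[i]) :=
  [/\ (2 <= n)%N, positive_coefs n q, N%:Z = qcs_order n q,
      root (map_poly intr (qcs_poly q)) y &
      exists2 e : 'Z_N -> 'I_n,
        allowed_exponents q e & increments y e phi].

(* The group generated by the cyclic permutations and the order reversal. *)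
Definition dihedral (N : nat) (g : 'Z_N -> 'Z_N) :=
  exists s : 'Z_N, (forall j, g j = s + j) \/ (forall j, g j = s - j).

Definition arises_up_to (R : realType) (n N : nat) (q : {poly int}) (y : R)
    (phi : 'Z_N -> R[i]) :=
  exists (g : 'Z_N -> 'Z_N) (c b : R[i]),
    [/\ dihedral g, c != 0 & arises n q y (fun j => c * phi (g j) + b)].

(* {1, y, ..., y^(n-1)} has n elements, so that an increment determines its
   exponent. For a negative y this fails only if y = -1 and n >= 3. *)
Definition distinct_powers (R : realType) (n : nat) (y : R) :=
  uniq [seq y ^+ k | k <- iota 0 n].

(* A connected segment {s, s + 1, ..., s + (l - 1)} of the cycle Z/NZ, possibly
   the whole cycle. *)
Definition segment (N : nat) (A : {set 'Z_N}) :=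
  exists (s : 'Z_N) (l : nat),
    (l <= N)%N /\ A = [set s + (i : nat)%:R | i : 'I_l].

Definition made_of_constant_segments (R : realType) (N : nat)
    (phi : 'Z_N -> R[i]) :=
  exists2 P : {set {set 'Z_N}}, partition P [set: 'Z_N] &
    forall A, A \in P ->
      [/\ segment A, (2 <= #|A|)%N & {in A &, forall i j, phi i = phi j}].

(* Main.v *)
Require Import Defs.
From mathcomp Require boolp.
From mathcomp Require Import zify ring.

(** Write u_j = phi(j+1) - phi(j). The equation at j + 1 involves only two
    consecutive increments: (gamma/2) (u - v)^2 = u^2 + v^2 ([qcs_incrP]). It is
    homogeneous and symmetric, so for gamma <> 2 it fixes the unordered pair
    {y, 1/y} of possible ratios u/v, with gamma = 2 (1 + y^2) / (1 - y)^2
    ([ratio_gamma], [qcs_ratio]). A real solution is therefore, up to a factor,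
    a sequence of increments y^(e j) whose exponents e form a closed walk with
    steps +1 and -1 on the integers, subject to the increments having sum zero.

    Everything else is about counting visits of such a walk. If the levels
    visited are 0, ..., n - 1, then each edge between levels k and k + 1 is
    crossed as often upwards as downwards ([walk_up_down]), say a_k > 0 times in
    each direction, so level k is visited a_k + a_(k-1) times: this is the
    coefficient of x^k in (x + 1) q(x), with q = sum a_k x^k ([walk_poly]). The
    increments then have sum p(y) ([sum_allowed]), so closing up means that y is
    a root of p. Conversely every choice of positive a_k comes from a walk,
    built edge by edge from the lowest level ([tour], [exists_allowed]).

    For the converse, if |y| is not 1 then an increment determines its exponent,
    so the walk can be read off from the sequence ([geometric_arises]). The only
    other possibility is y = -1, since y = 1 makes all increments equal and
    nonzero; the increments then alternate and two levels suffice
    ([alternating_arises]). The polynomial is unique once y is chosen because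
    the lowest level is 0 ([arises_unique]); replacing y by 1/y turns the walk
    upside down and reverses the polynomial ([reversed_arises]).

    For gamma = 2 the equation says that u v = 0, that is, every term equals one
    of its two neighbours; for gamma = 1 it says that (u + v)^2 = 0. *)

Set Implicit Arguments.
Unset Strict Implicit.
Unset Printing Implicit Defensive.

Import Order.TTheory GRing.Theory Num.Theory.
Local Open Scope ring_scope.
Local Open Scope complex_scope.

(** * Functions on the cycle and their increments *)

Lemma Zp_ind_succ (N : nat) (P : 'Z_N -> Prop) :
  P 0 -> (forall j, P j -> P (j + 1)) -> forall j, P j.
Proof.
move=> P0 PS j; rewrite -(natr_Zp j).
by elim: (j : nat) => [//|i IH]; rewrite -addn1 natrD; apply: PS.
Qed.

Lemma ord_succ_cases (M : nat) (j : 'I_M.+2) :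
  (j + 1 = 0 /\ j = M.+1 :> nat) \/ ((j + 1)%R = j.+1 :> nat).
Proof.
have sE : (j + 1)%R = (j.+1 %% M.+2)%N :> nat by rewrite /= modnDmr addn1.
have [ltj | gej] := ltnP j.+1 M.+2; first by right; rewrite sE modn_small.
have jE : j = M.+1 :> nat by have := ltn_ord j; lia.
by left; split=> //; apply: ord_inj; rewrite sE jE modnn.
Qed.

Lemma sum_cyclic_shift (V : nmodType) (N : nat) (F : 'Z_N -> V) :
  \sum_j F (j + 1) = \sum_j F j.
Proof. by rewrite [RHS](reindex_inj (addIr 1)). Qed.

Definition incr (V : zmodType) (N : nat) (phi : 'Z_N -> V) (j : 'Z_N) : V :=
  phi (j + 1) - phi j.

Lemma sum_incr (V : zmodType) (N : nat) (phi : 'Z_N -> V) :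
  \sum_j incr phi j = 0.
Proof. by rewrite sumrB sum_cyclic_shift subrr. Qed.

(** The sequence with prescribed increments closes up because their total is
    zero. *)
Lemma exists_of_incr (V : zmodType) (N : nat) (u : 'Z_N -> V) (x0 : V) :
  \sum_j u j = 0 -> exists2 phi : 'Z_N -> V, phi 0 = x0 & incr phi =1 u.
Proof.
move=> u0; pose S (k : nat) := \sum_(i < k) u (i : nat)%:R.
have shift a b : x0 + a - (x0 + b) = a - b.
  by rewrite opprD addrACA subrr add0r.
exists (fun j => x0 + S j) => [|j]; first by rewrite /S big_ord0 addr0.
have -> : incr (fun j : 'Z_N => x0 + S j) j = S (j + 1)%R - S j by apply: shift.
case: (ord_succ_cases j) => [[-> jE]|->]; last first.
  by rewrite /S big_ord_recr /= addrAC subrr add0r natr_Zp.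
rewrite {1}/S big_ord0 sub0r; apply/eqP; rewrite eqr_oppLR -addr_eq0; apply/eqP.
rewrite -[RHS]u0 big_ord_recr /=; congr (_ + _); last first.
  by congr u; apply: ord_inj; rewrite jE.
rewrite /S jE; apply: eq_bigr => i _; congr u.
by rewrite -[RHS]natr_Zp.
Qed.

Lemma incr_inj (V : zmodType) (N : nat) (phi psi : 'Z_N -> V) :
  incr phi =1 incr psi -> phi 0 = psi 0 -> phi =1 psi.
Proof.
move=> eqi eq0; apply: Zp_ind_succ => // j eqj.
by rewrite -[LHS](subrK (phi j)) [_ - _]eqi eqj subrK.
Qed.

Lemma nonconstant_incr (R : realType) (N : nat) (phi : 'Z_N -> R[i]) :
  nonconstant phi -> exists j, incr phi j != 0.
Proof.
move=> [i [j neq]].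
case: (boolP [exists k, incr phi k != 0]) => [/existsP//|/existsPn inc0].
case: neq.
suff const0 k : phi k = phi 0 by rewrite !const0.
elim/Zp_ind_succ: k => [//|k IH]; rewrite -{}IH.
by have := inc0 k; rewrite negbK subr_eq0 => /eqP.
Qed.

(** * The equation in terms of increments *)

Lemma qcs_incrP (R : realType) (N : nat) (gamma : R) (phi : 'Z_N -> R[i]) :
  qcs_eq gamma phi <->
  forall j, (gamma / 2)%:C * (incr phi j - incr phi (j + 1)) ^+ 2
            = incr phi j ^+ 2 + incr phi (j + 1) ^+ 2.
Proof.
rewrite /incr; split=> [H j | H j].
  have := H (j + 1); rewrite addrK => Hj.
  transitivity ((gamma / 2)%:C *
    (2 * phi (j + 1) - phi j - phi (j + 1 + 1)) ^+ 2); first by ring.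
  by rewrite Hj; ring.
have := H (j - 1); rewrite subrK => Hj.
transitivity ((gamma / 2)%:C *
    (phi j - phi (j - 1) - (phi (j + 1) - phi j)) ^+ 2); first by ring.
by rewrite Hj; ring.
Qed.

Lemma qcs_affine (R : realType) (N : nat) (gamma : R) (phi : 'Z_N -> R[i])
  (c b : R[i]) :
  c != 0 ->
  qcs_eq gamma (fun j => c * phi j + b) <-> qcs_eq gamma phi.
Proof.
move=> c0; rewrite !qcs_incrP.
have incE j : incr (fun j => c * phi j + b) j = c * incr phi j.
  by rewrite /incr; ring.
split=> H j; have := H j; rewrite !incE => {}H.
  apply: (mulfI (expf_neq0 2 c0)).
  rewrite mulrCA -exprMn mulrBr H; ring.
by rewrite -mulrBr !exprMn mulrCA H mulrDr.
Qed.

Lemma qcs_dihedral (R : realType) (N : nat) (gamma : R) (phi : 'Z_N -> R[i])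
  (g : 'Z_N -> 'Z_N) :
  dihedral g -> qcs_eq gamma (fun j => phi (g j)) <-> qcs_eq gamma phi.
Proof.
move=> [s [gE | gE]]; split=> H j.
- have := H (j - s); rewrite !gE.
  have -> : s + (j - s) = j by ring.
  have -> : s + (j - s - 1) = j - 1 by ring.
  by have -> : s + (j - s + 1) = j + 1 by ring.
- by rewrite /= !gE !addrA; apply: H.
- have := H (s - j); rewrite !gE.
  have -> : s - (s - j) = j by ring.
  have -> : s - (s - j - 1) = j + 1 by ring.
  have -> : s - (s - j + 1) = j - 1 by ring.
  by rewrite (addrC (_ ^+ 2)) addrAC.
- have := H (s - j); rewrite /= !gE.
  have -> : s - (j - 1) = s - j + 1 by ring.
  have -> : s - (j + 1) = s - j - 1 by ring.
  by rewrite (addrC (_ ^+ 2)) addrAC.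
Qed.

(** * Closed walks and the polynomial counting their visits *)

Lemma coef_qcs_poly (q : {poly int}) (k : nat) :
  (qcs_poly q)`_k = (if k is k'.+1 then q`_k' else 0) + q`_k.
Proof. by rewrite /qcs_poly mulrDl mul1r coefD coefXM; case: k. Qed.

Lemma coef_positive_coefs (n : nat) (q : {poly int}) (k : nat) :
  positive_coefs n q -> 0 <= q`_k.
Proof.
move=> [sq q_gt0]; have [lt|ge] := ltnP k n.-1; first exact/ltW/q_gt0.
by rewrite nth_default ?sq.
Qed.

Lemma coef_qcs_poly_gt0 (n : nat) (q : {poly int}) (k : nat) :
  (2 <= n)%N -> positive_coefs n q -> (k < n)%N -> 0 < (qcs_poly q)`_k.
Proof.
move=> n2 qP kn; rewrite coef_qcs_poly.
case: k kn => [|k] kn; first by rewrite add0r; apply: qP.2; lia.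
by apply: ltr_wpDr; [exact: coef_positive_coefs qP | apply: qP.2; lia].
Qed.

Lemma size_qcs_poly (n : nat) (q : {poly int}) :
  (2 <= n)%N -> positive_coefs n q -> size (qcs_poly q) = n.
Proof.
move=> n2 [sq _].
have X1 : size ('X + 1 : {poly int}) = 2 by rewrite -[1]/(1%:P) size_XaddC.
have X0 : 'X + 1 != 0 :> {poly int} by rewrite -size_poly_eq0 X1.
have q0 : q != 0 by rewrite -size_poly_eq0 sq; lia.
by rewrite /qcs_poly size_mul // X1 sq; lia.
Qed.

Lemma sum_coef_qcs_poly (n : nat) (q : {poly int}) :
  (2 <= n)%N -> positive_coefs n q ->
  \sum_(k < n) (qcs_poly q)`_k = qcs_order n q.
Proof.
move=> n2 qP; have sp := size_qcs_poly n2 qP.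
have -> : \sum_(k < n) (qcs_poly q)`_k = (qcs_poly q).[1].
  by rewrite (@horner_coef_wide _ n) ?sp //; apply: eq_bigr => k _;
    rewrite expr1n mulr1.
rewrite hornerM hornerD hornerX -[1%R in X in _ + X]/(1%:P) hornerC.
rewrite (@horner_coef_wide _ n.-1) ?qP.1 //; congr (_ * _).
by under eq_bigr do rewrite expr1n mulr1.
Qed.

Lemma allowed_level (N n : nat) (q : {poly int}) (e : 'Z_N -> 'I_n) (k : 'I_n) :
  allowed_exponents q e -> (\sum_j (e j == k))%N%:Z = (qcs_poly q)`_k.
Proof.
case=> /(_ k) <- _; congr Posz; rewrite -sum1dep_card [RHS]big_mkcond /=.
by apply: eq_bigr => j _; case: eqP.
Qed.

(** Grouping the positions by level turns the total of the increments into a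
    value of the counting polynomial. *)
Lemma sum_allowed (A : comNzRingType) (N n : nat) (q : {poly int})
    (e : 'Z_N -> 'I_n) (y : A) :
  (2 <= n)%N -> positive_coefs n q -> allowed_exponents q e ->
  \sum_j y ^+ e j = (map_poly intr (qcs_poly q)).[y].
Proof.
move=> n2 qP eP.
have sp : (size (map_poly intr (qcs_poly q) : {poly A}) <= n)%N.
  by rewrite -(size_qcs_poly n2 qP) size_poly.
rewrite (horner_coef_wide _ sp) (partition_big e xpredT) //=.
apply: eq_bigr => k _; rewrite coef_map /= -(allowed_level k eP).
rewrite (eq_bigr (fun=> y ^+ k)) => [|j /eqP-> //].
rewrite sumr_const mulr_natl; congr (_ *+ _).
rewrite -sum1_card [LHS]big_mkcond /=.
by apply: eq_bigr => j _; rewrite unfold_in -[eqn _ _]/(e j == k);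
  case: (e j == k).
Qed.

Lemma allowed_order (N n : nat) (q : {poly int}) (e : 'Z_N -> 'I_n) :
  (2 <= N)%N -> (2 <= n)%N -> positive_coefs n q -> allowed_exponents q e ->
  N%:Z = qcs_order n q.
Proof.
move=> N2 n2 qP eP; rewrite -sum_coef_qcs_poly //.
under eq_bigr do rewrite -(allowed_level _ eP).
rewrite -(big_morph Posz PoszD (erefl _)) exchange_big /=.
have sum1 j : (\sum_(k < n) (e j == k))%N = 1%N.
  rewrite (bigD1 (e j)) //= eqxx big1 // => k; rewrite eq_sym.
  by move/negbTE->.
by under eq_bigr do rewrite sum1; rewrite sum1_card card_ord Zp_cast.
Qed.

Lemma allowed_attained (N n : nat) (q : {poly int}) (e : 'Z_N -> 'I_n)
    (k : nat) :
  (2 <= n)%N -> positive_coefs n q -> allowed_exponents q e -> (k < n)%N ->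
  exists j, e j = k :> nat.
Proof.
move=> n2 qP eP kn; have := coef_qcs_poly_gt0 n2 qP kn.
have [eP1 _] := eP; rewrite -(eP1 (Ordinal kn)) ltz_nat card_gt0.
by case/set0Pn=> j; rewrite inE => /eqP ej; exists j; rewrite ej.
Qed.

Definition walk (N : nat) (e : 'Z_N -> nat) :=
  forall j : 'Z_N, (e (j + 1) = (e j).+1) \/ (e j = (e (j + 1)).+1).

(** Without an upward step from k to k + 1, a walk at level at most k could
    never rise above k, even after going around the cycle. *)
Lemma walk_crosses (N : nat) (e : 'Z_N -> nat) (k : nat) (i j : 'Z_N) :
  walk e -> (e i <= k)%N -> (k < e j)%N ->
  (0 < \sum_j ((e j == k) && (e (j + 1)%R == k.+1)))%N.
Proof.
move=> we eik kej; rewrite lt0n; apply/negP; rewrite sum_nat_eq0.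
move=> /forallP no_up;
  suff : (e (i + (j - i))%R <= k)%N by rewrite addrC subrK; lia.
elim/Zp_ind_succ: (j - i) => [|l IH]; first by rewrite addr0.
rewrite addrA; have := no_up (i + l); have := we (i + l).
move: IH; rewrite implyTb eqb0.
by move: (e (i + l)) (e (i + l + 1)) => a b; lia.
Qed.

(** Every edge is crossed as often upwards as downwards: the number of
    positions at level at most k is the same before and after a step. *)
Lemma walk_up_down (N : nat) (e : 'Z_N -> nat) (k : nat) :
  walk e ->
  (\sum_j ((e j == k) && (e (j + 1)%R == k.+1)) =
   \sum_j ((e j == k.+1) && (e (j + 1)%R == k)))%N.
Proof.
move=> we; apply: (@addnI (\sum_j (e (j + 1)%R <= k))%N).
rewrite [X in (_ = X + _)%N](@sum_cyclic_shift nat N (fun j => (e j <= k)%N :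
  nat)).
rewrite -!big_split; apply: eq_bigr => j _ /=; have := we j.
by move: (e j) (e (j + 1)) => a b; lia.
Qed.

(** The coefficients of q are the numbers of upward crossings of the edges
    between consecutive levels; as many crossings go down, so level k is left
    as often as the edges on its two sides are crossed upwards. *)
Lemma walk_poly (N n : nat) (e : 'Z_N -> 'I_n) (i j : 'Z_N) :
  (2 <= N)%N -> (2 <= n)%N -> walk (fun j => e j) ->
  e i = 0%N :> nat -> e j = n.-1 :> nat ->
  exists2 q, positive_coefs n q & allowed_exponents q e /\ N%:Z = qcs_order n q.
Proof.
move=> N2 n2 we ei ej; pose f j : nat := e j; have wf : walk f by [].
pose U k := (\sum_j ((f j == k) && (f (j + 1)%R == k.+1)))%N.
have U_gt0 k : (k < n.-1)%N -> 0 < (U k)%:Z.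
  by move=> kn; rewrite ltz_nat; apply: (walk_crosses wf (i := i) (j := j));
    rewrite /f; lia.
have U_top k : (n.-1 <= k)%N -> U k = 0%N.
  move=> kn; apply: big1 => l _; rewrite /f.
  have := ltn_ord (e (l + 1)); lia.
pose q : {poly int} := \poly_(k < n.-1) (U k)%:Z.
have qE k : q`_k = U k.
  by rewrite coef_poly; case: ltnP => // /U_top ->.
have qP : positive_coefs n q.
  split=> [|k kn]; last by rewrite qE U_gt0.
  by rewrite size_poly_eq // gt_eqF // U_gt0; lia.
have eP : allowed_exponents q e.
  split=> [k | //]; rewrite coef_qcs_poly !qE -sum1dep_card [in LHS]big_mkcond
    /=.
  have levelE l : (if e l == k then 1 else 0)%N = (f l == k :> nat).
    by rewrite /f -[e l == k]/(e l == k :> nat); case: eqP.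
  under eq_bigr do rewrite levelE.
  move: (nat_of_ord k) => [|{levelE}k].
    rewrite add0r; congr Posz; apply: eq_bigr => l _; have := wf l.
    by move: (f l) (f (l + 1)) => a b; lia.
  rewrite qE -PoszD {1}/U (walk_up_down _ wf) -big_split; congr Posz.
  apply: eq_bigr => l _ /=; have := wf l.
  by move: (f l) (f (l + 1)) => a b; lia.
by exists q => //; split=> //; apply: allowed_order eP.
Qed.

(** * Existence of walks with prescribed numbers of crossings *)

(** A closed walk from level k that crosses the edge above level k + i exactly
    s`_i times in each direction: go up, tour the higher levels, come back, and
    use up the remaining crossings of the lowest edge by going back and
    forth. *)
Fixpoint tour (k : nat) (s : seq nat) : seq nat :=
  if s is a :: s' then
    k.+1 :: tour k.+1 s' ++ k :: flatten (nseq a.-1 [:: k.+1; k])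
  else [::].

Definition adjacent (l m : nat) := (m == l.+1) || (l == m.+1).

Lemma tour_path (k : nat) (s : seq nat) :
  path adjacent k (tour k s) && (last k (tour k s) == k).
Proof.
elim: s k => [|a s IH] k; first by rewrite /= eqxx.
have /andP[pathk /eqP lastk] := IH k.+1.
have /andP[pathf lastf] : path adjacent k (flatten (nseq a.-1 [:: k.+1; k])) &&
    (last k (flatten (nseq a.-1 [:: k.+1; k])) == k).
  by elim: a.-1 => [|b IHb] /=; rewrite ?eqxx // /adjacent !eqxx orbT.
rewrite /= cat_path last_cat /= pathk lastk pathf lastf.
by rewrite /adjacent !eqxx orbT.
Qed.

Lemma size_tour (k : nat) (s : seq nat) :
  all (leq 1) s -> size (tour k s) = (2 * sumn s)%N.
Proof.
elim: s k => [//|[//|a] s IH] k /= pos_s; rewrite size_cat IH //=.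
rewrite size_flatten /shape map_nseq sumn_nseq /=; lia.
Qed.

(** Level k + i is entered from below through the edge counted by s`_(i-1) and
    from above through the edge counted by s`_i; putting a 0 in front of s gives
    the lowest level no edge below. *)
Lemma count_tour (k : nat) (s : seq nat) (m : nat) :
  all (leq 1) s ->
  count_mem m (tour k s) =
    (if (m < k)%N then 0 else nth 0 (0 :: s) (m - k) + nth 0 s (m - k))%N.
Proof.
elim: s k => [|[//|a] s IH] k pos_s.
  by rewrite /= nth_nil; case: ifP; case: (_ - _)%N => //= l; rewrite nth_nil.
have count_back : count_mem m (flatten (nseq a [:: k.+1; k])) =
    (a * ((k.+1 == m) + (k == m)))%N.
  by elim: (a) => [//|b IHb] /=; rewrite IHb mulSn !addnA.
rewrite /= count_cat /= count_back IH //=.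
have [mk | km] := ltnP m k.
  have mk1 : (m < k.+1)%N by lia.
  by rewrite mk1 !gtn_eqF ?muln0.
case Ei: (m - k)%N => [|i].
  have -> : m = k by lia.
  by rewrite ltnSn eqxx gtn_eqF //= !add0n muln1 add1n.
have -> : (m < k.+1)%N = false by lia.
have -> : (m - k.+1)%N = i by lia.
case: i Ei => [|i] Ei /=.
  have -> : k.+1 = m by lia.
  by rewrite eqxx ltn_eqF //=; lia.
by rewrite !ltn_eqF ?muln0; lia.
Qed.

(** The list [tour 0 s] omits the starting level and contains the final one, and
    both are 0; read cyclically, it is therefore a closed walk. *)
Lemma exists_allowed (N n : nat) (q : {poly int}) :
  (2 <= N)%N -> (2 <= n)%N -> positive_coefs n q -> N%:Z = qcs_order n q ->
  exists e : 'Z_N -> 'I_n, allowed_exponents q e.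
Proof.
case: N n => [|[|M]] // [|n] // _ n2 qP NE.
pose s := mkseq (fun k => absz q`_k) n; pose W := tour 0 s.
have absq k : (absz q`_k)%:Z = q`_k by rewrite gez0_abs ?(coef_positive_coefs _
  qP).
have nth_s k : (nth 0%N s k)%:Z = q`_k.
  have [lt|ge] := ltnP k n; first by rewrite nth_mkseq.
  by rewrite !nth_default ?size_mkseq ?qP.1.
have pos_s : all (leq 1) s.
  apply/(all_nthP 0%N) => k; rewrite size_mkseq => kn.
  by rewrite -ltz_nat nth_s; apply: qP.2.
have countW k : (count_mem k W)%:Z = (qcs_poly q)`_k.
  rewrite count_tour // subn0 PoszD nth_s coef_qcs_poly.
  by case: k => [//|k]; rewrite /= nth_s.
have sizeW : size W = M.+2.
  apply/eqP; rewrite -eqz_nat NE size_tour // PoszM /qcs_order; apply/eqP;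
    congr (_ * _).
  rewrite sumnE big_map -[n in iota 0 n]subn0 -/(index_iota 0 n) big_mkord
    (big_morph Posz PoszD (erefl _)).
  by apply: eq_bigr => k _; rewrite absq.
have W_lt (j : 'I_M.+2) : (nth 0 W j < n.+1)%N.
  rewrite ltnNge; apply/negP => Wj.
  have : (0 < count_mem (nth 0%N W j) W)%N.
    by rewrite -has_count has_pred1 mem_nth // sizeW.
  rewrite -ltz_nat countW nth_default // (size_qcs_poly n2 qP) //.
pose e (j : 'I_M.+2) : 'I_n.+1 := inord (nth 0%N W j).
have eE j : e j = nth 0%N W j :> nat by rewrite inordK.
have /andP[/(pathP 0%N) adjW /eqP lastW] := tour_path 0 s.
exists e; split=> [k | j].
  rewrite -countW -sum1_count -sum1dep_card; congr Posz.
  rewrite (big_nth 0%N) sizeW big_mkord.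
  by apply: eq_bigl => j; rewrite -eE.
have step : adjacent (e j) (e (j + 1)).
  rewrite !eE; case: (ord_succ_cases j) => [[-> jE]|jE].
    have -> : nth 0%N W j = 0%N by rewrite -[RHS]lastW -nth_last -/W sizeW jE.
    by have := adjW 0%N; rewrite -/W sizeW => /(_ isT).
  have := adjW (j + 1); rewrite -/W sizeW => /(_ (ltn_ord _)).
  by rewrite jE.
by case/orP: step => /eqP ->; [left | right].
Qed.

(** * Sequences with walking increments *)

Definition gamma_of (R : realType) (y : R) : R := 2 * (1 + y ^+ 2) / (1 - y) ^+
  2.

Lemma qcs_root_lt0 (R : realType) (n : nat) (q : {poly int}) (y : R) :
  (2 <= n)%N -> positive_coefs n q -> root (map_poly intr (qcs_poly q)) y ->
  y < 0.
Proof.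
move=> n2 qP; apply: contraTT; rewrite -leNgt => y_ge0; apply/negP => /rootP.
have sp : (size (map_poly intr (qcs_poly q) : {poly R}) <= n)%N.
  by rewrite -(size_qcs_poly n2 qP) size_poly.
rewrite (horner_coef_wide _ sp); apply/eqP; rewrite gt_eqF //.
rewrite (bigD1 (Ordinal (ltnW n2))) //= expr0 mulr1 coef_map /=.
apply: ltr_wpDr; last by rewrite ltr0z (coef_qcs_poly_gt0 n2 qP) ?(ltnW n2).
apply: sumr_ge0 => k _; rewrite coef_map mulr_ge0 ?exprn_ge0 //=.
by rewrite ler0z ltW // (coef_qcs_poly_gt0 n2 qP).
Qed.

Lemma gamma_of_lt2 (R : realType) (y : R) : y < 0 -> gamma_of y < 2.
Proof.
move=> y0; have y1 : 0 < 1 - y by rewrite subr_gt0 (lt_trans y0).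
rewrite /gamma_of ltr_pdivrMr ?exprn_gt0 // -subr_gt0.
have -> : 2 * (1 - y) ^+ 2 - 2 * (1 + y ^+ 2) = 4 * - y by ring.
by rewrite mulr_gt0 ?oppr_gt0.
Qed.

(** The value of gamma determines the unordered pair of y and 1/y: the
    difference of the two values is a multiple of (y - z)(1 - y z). *)
Lemma gamma_of_eq (R : realType) (y z : R) :
  y < 0 -> z < 0 -> gamma_of y = gamma_of z -> y = z \/ y = z^-1.
Proof.
move=> y0 z0; have y1 : 1 - y != 0 by rewrite subr_eq0 gt_eqF // (lt_trans y0).
have z1 : 1 - z != 0 by rewrite subr_eq0 gt_eqF // (lt_trans z0).
move/eqP; rewrite /gamma_of eqr_div ?expf_neq0 // -subr_eq0.
have -> : 2 * (1 + y ^+ 2) * (1 - z) ^+ 2 - 2 * (1 + z ^+ 2) * (1 - y) ^+ 2 =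
  4 * ((y - z) * (1 - y * z)) by ring.
rewrite !mulf_eq0 pnatr_eq0 /= !subr_eq0 => /orP[/eqP|/eqP yz]; first by left.
right; apply: (mulIf (ltr0_neq0 z0)); rewrite -yz mulVf //.
exact: ltr0_neq0.
Qed.

(** The equation at one position says that the ratio of the two increments is a
    root of a reciprocal quadratic polynomial determined by gamma. *)
Lemma ratio_gamma (R : realType) (gamma y u v : R) :
  y < 0 -> u != 0 -> v != 0 -> v = y * u \/ u = y * v ->
  (gamma / 2 * (u - v) ^+ 2 = u ^+ 2 + v ^+ 2) <-> gamma = gamma_of y.
Proof.
move=> y0 u0 v0.
wlog: u v u0 v0 / v = y * u => [WL uv | -> _].
  case: (uv) => [vE | uE]; first by apply: WL => //; left.
  rewrite -(WL v u) //; last by left.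
  have -> : (v - u) ^+ 2 = (u - v) ^+ 2 by ring.
  by rewrite [v ^+ 2 + _]addrC.
have y1 : 1 - y != 0 by rewrite subr_eq0 gt_eqF // (lt_trans y0).
rewrite /gamma_of; split=> [H | ->]; last by field.
apply: (mulIf (expf_neq0 2 y1)); rewrite divfK ?expf_neq0 //.
apply: (mulIf (expf_neq0 2 u0)); apply: (@mulIf _ 2^-1);
  first by rewrite invr_eq0 pnatr_eq0.
transitivity (gamma / 2 * (u - y * u) ^+ 2); first by field.
by rewrite H; field.
Qed.

Lemma qcs_eq_real (R : realType) (N : nat) (gamma : R) (phi : 'Z_N -> R[i])
    (v : 'Z_N -> R) :
  (forall j, incr phi j = (v j)%:C) ->
  qcs_eq gamma phi <->
  forall j, gamma / 2 * (v j - v (j + 1)) ^+ 2 = v j ^+ 2 + v (j + 1) ^+ 2.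
Proof.
move=> incE; rewrite qcs_incrP; split=> H j.
  apply: complexI; rewrite rmorphM rmorphXn rmorphB rmorphD !rmorphXn /= -!incE.
  exact: H.
by rewrite !incE -rmorphB -!rmorphXn -rmorphD -rmorphM H.
Qed.

Lemma increments_qcs (R : realType) (n N : nat) (gamma y : R)
    (e : 'Z_N -> 'I_n) (phi : 'Z_N -> R[i]) :
  y < 0 -> walk (fun j => e j) -> increments y e phi ->
  qcs_eq gamma phi <-> gamma = gamma_of y.
Proof.
move=> y0 we incE; rewrite (qcs_eq_real _ (v := fun j => y ^+ e j)) //.
have step j := ratio_gamma gamma y0 (expf_neq0 (e j) (ltr0_neq0 y0))
  (expf_neq0 (e (j + 1)) (ltr0_neq0 y0)).
have ratio j : y ^+ e (j + 1) = y * y ^+ e j \/ y ^+ e j = y * y ^+ e (j + 1).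
  by case: (we j) => ->; rewrite exprS; [left | right].
split=> [H | gammaE j]; first exact/(step 0 (ratio 0))/H.
exact/(step j (ratio j)).
Qed.

Lemma increments_real (R : realType) (n N : nat) (y : R)
    (e : 'Z_N -> 'I_n) (phi : 'Z_N -> R[i]) :
  increments y e phi -> real_seq phi.
Proof.
move=> incE; exists (fun j => phi j - phi 0).
  by exists 1, (- phi 0); rewrite oner_eq0; split=> //; left=> j; rewrite mul1r.
apply: Zp_ind_succ => [|j real_j]; first by rewrite subrr real0.
rewrite -(subrK (phi j) (phi (j + 1))) incE -addrA rpredD //.
by apply/complex_realP; exists (y ^+ e j).
Qed.

Lemma increments_sum (R : realType) (n N : nat) (y : R) (e : 'Z_N -> 'I_n)
    (phi : 'Z_N -> R[i]) :
  increments y e phi -> \sum_j y ^+ e j = 0.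
Proof.
move=> incE; apply: complexI; rewrite rmorph_sum rmorph0 -[RHS](sum_incr phi).
by apply: eq_bigr => j _; rewrite /incr incE.
Qed.

Lemma increments_exists (R : realType) (n N : nat) (y : R) (e : 'Z_N -> 'I_n)
    (x0 : R[i]) :
  \sum_j y ^+ e j = 0 ->
  exists! phi : 'Z_N -> R[i], phi 0 = x0 /\ increments y e phi.
Proof.
move=> sum0.
have [|phi phi0 incE] := @exists_of_incr R[i] N (fun j => (y ^+ e j)%:C) x0.
  by rewrite -rmorph_sum sum0 rmorph0.
exists phi; split=> // psi [psi0 incE']; apply: boolp.funext.
by apply: incr_inj => [j|]; [rewrite incE [RHS]incE' | rewrite phi0 psi0].
Qed.

Lemma arises_up_to_qcs (R : realType) (n N : nat) (q : {poly int}) (gamma y : R)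
    (phi : 'Z_N -> R[i]) :
  arises_up_to n q y phi -> qcs_eq gamma phi <-> gamma = gamma_of y.
Proof.
move=> [g [c [b [dg c0 [n2 qP _ py [e [_ we] incE]]]]]].
rewrite -(increments_qcs gamma (qcs_root_lt0 n2 qP py) we incE).
by rewrite (qcs_affine _ (fun j => phi (g j))) // qcs_dihedral.
Qed.

(** * Recovering the walk from a sequence *)

Lemma exprz_inj_norm (R : realType) (y : R) :
  y != 0 -> `|y| != 1 -> injective (fun k : int => y ^ k).
Proof.
move=> y0 y1 i j /= eij; apply: (@ieexprIz R `|y|) => //;
  first by rewrite normr_gt0.
have normE k : `|y| ^ k = `|y ^ k|.
  by case: k => k; rewrite ?NegzE -?exprnN ?normfV normrX.
by rewrite !normE eij.
Qed.

Lemma expr_inj_norm (R : realType) (y : R) :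
  y != 0 -> `|y| != 1 -> injective (fun k : nat => y ^+ k).
Proof.
by move=> y0 y1 i j eij; have [] := @exprz_inj_norm R y y0 y1 i j eij.
Qed.

Lemma norm_neq1 (R : realType) (y : R) : y < 0 -> y != -1 -> `|y| != 1.
Proof. by move=> y0; rewrite ltr0_norm // eqr_oppLR. Qed.

Lemma distinct_powers_norm (R : realType) (n : nat) (y : R) :
  y != 0 -> `|y| != 1 -> distinct_powers n y.
Proof.
by move=> y0 y1; rewrite /distinct_powers map_inj_uniq ?iota_uniq //;
  apply: expr_inj_norm.
Qed.

Lemma distinct_powersN1 (R : realType) (n : nat) :
  distinct_powers n (-1 : R) = (n <= 2)%N.
Proof.
case: n => [|[|[|n]]] //=; rewrite /distinct_powers /= ?inE ?expr0 ?expr1.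
  by rewrite andbT -addr_eq0 -[1 + 1]/(2%:R) pnatr_eq0.
by rewrite sqrrN expr1n eqxx !orbT.
Qed.

Lemma distinct_powersV (R : realType) (n : nat) (y : R) :
  distinct_powers n y -> distinct_powers n y^-1.
Proof.
rewrite /distinct_powers => dy.
have -> : [seq y^-1 ^+ k | k <- iota 0 n] = [seq z^-1 | z <- [seq y ^+ k | k <-
  iota 0 n]].
  by rewrite -map_comp; apply: eq_map => k /=; rewrite exprVn.
by rewrite map_inj_uniq //; apply: invr_inj.
Qed.

(** The coefficients of q count crossings, and y is a root because the
    increments have sum zero. *)
Lemma arises_of_walk (R : realType) (n N : nat) (y : R) (e : 'Z_N -> 'I_n)
    (i j : 'Z_N) (phi : 'Z_N -> R[i]) :
  (2 <= N)%N -> (2 <= n)%N -> walk (fun l => e l) ->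
  e i = 0%N :> nat -> e j = n.-1 :> nat -> increments y e phi ->
  exists2 q, arises n q y phi & allowed_exponents q e.
Proof.
move=> N2 n2 we ei ej incE; have [q qP [eP NE]] := walk_poly N2 n2 we ei ej.
exists q => //; split=> //; last by exists e.
by apply/rootP; rewrite -(sum_allowed y n2 qP eP); apply: increments_sum incE.
Qed.

Lemma dihedral_id (N : nat) : dihedral (fun j : 'Z_N => j).
Proof. by exists 0; left=> j; rewrite add0r. Qed.

(** The case of ratio -1: two levels are enough, since the powers of -1 take
    only two values. *)
Lemma alternating_arises (R : realType) (N : nat) (phi : 'Z_N -> R[i]) :
  (2 <= N)%N -> nonconstant phi ->
  (forall j, incr phi (j + 1) = - incr phi j) ->
  exists q, arises_up_to 2 q (-1) phi.
Proof.
move=> N2 /nonconstant_incr[j0 incj0] alt; pose u := incr phi 0.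
have inc_pm j : incr phi j = u \/ incr phi j = - u.
  elim/Zp_ind_succ: j => [|j IH]; first by left.
  by rewrite alt; case: IH => ->; rewrite ?opprK; [right | left].
have u0 : u != 0.
  by apply: contraNneq incj0 => u0; case: (inc_pm j0) => ->; rewrite u0 ?oppr0.
have uNu : - u != u by rewrite -subr_eq0 -opprD oppr_eq0 -mulr2n mulrn_eq0.
pose e (j : 'Z_N) : 'I_2 := if incr phi j == u then ord0 else ord_max.
have e0 : e 0 = 0%N :> nat by rewrite /e eqxx.
have e1 : e 1 = 1%N :> nat.
  have inc1 : incr phi 1 = - u by rewrite -alt add0r.
  by rewrite /e inc1 (negbTE uNu).
have we : walk (fun j => e j).
  move=> j; rewrite /e alt; case: (inc_pm j) => ->.
    by rewrite eqxx (negbTE uNu); left.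
  by rewrite opprK eqxx (negbTE uNu); right.
pose psi j := u^-1 * phi j + 0.
have incE : increments (-1) e psi.
  move=> j; have -> : psi (j + 1) - psi j = u^-1 * incr phi j.
    by rewrite /psi /incr; ring.
  rewrite /e; case: (inc_pm j) => ->; first by rewrite eqxx mulVf // expr0.
  by rewrite (negbTE uNu) mulrN mulVf // expr1 rmorphN1.
have [q qP _] := arises_of_walk N2 (leqnn 2) we e0 e1 incE.
by exists q, (fun j => j), u^-1, 0; split=> //;
  [apply: dihedral_id | rewrite invr_eq0].
Qed.

(** A conjugation in the normalization can be undone: it fixes the real numbers
    and conjugates the factor. *)
Lemma real_seq_incr (R : realType) (N : nat) (phi : 'Z_N -> R[i]) :
  real_seq phi ->
  exists (c : R[i]) (v : 'Z_N -> R), c != 0 /\ forall j, c * incr phi j = (v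
    j)%:C.
Proof.
case=> psi [a [b [a0 psiE]]] psi_real.
have incE : exists2 c, c != 0 & forall j, c * incr phi j \is Num.real.
  case: psiE => psiE.
    exists a => // j; rewrite /incr mulrBr.
    have -> : a * phi (j + 1) - a * phi j = psi (j + 1) - psi j.
      by rewrite !psiE; ring.
    exact: rpredB.
  exists (conjc a) => [|j]; first by rewrite fmorph_eq0.
  have -> : conjc a * incr phi j = conjc (psi (j + 1) - psi j).
    rewrite !psiE opprD addrACA subrr addr0 -mulrBr rmorphM rmorphB /=.
    by rewrite !conjcK.
  have /complex_realP[r ->] : psi (j + 1) - psi j \is Num.real by apply: rpredB.
  by rewrite conjc_real; apply/complex_realP; exists r.
case: incE => c c0 c_real; exists c, (fun j => complex.Re (c * incr phi j));
  split=> // j.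
by rewrite RRe_real.
Qed.

Lemma incr_affine (R : realType) (N : nat) (phi : 'Z_N -> R[i]) (c b : R[i]) (j
  : 'Z_N) :
  incr (fun i => c * phi i + b) j = c * incr phi j.
Proof. by rewrite /incr; ring. Qed.

(** Consecutive increments satisfy one reciprocal quadratic equation, so their
    ratio is one of two mutually inverse numbers. *)
Lemma qcs_ratio (R : realType) (N : nat) (gamma : R) (v : 'Z_N -> R) (i : 'Z_N)
  :
  gamma != 2 -> v i != 0 ->
  (forall j, gamma / 2 * (v j - v (j + 1)) ^+ 2 = v j ^+ 2 + v (j + 1) ^+ 2) ->
  exists2 y, y != 0 &
    forall j, v j != 0 /\ (v (j + 1) = y * v j \/ v j = y * v (j + 1)).
Proof.
move=> g2 vi H; pose A := gamma / 2 - 1.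
have A0 : A != 0.
  by rewrite subr_eq0 -(inj_eq (mulIf (_ : 2 != 0 :> R))) ?divfK ?mul1r
    ?pnatr_eq0.
have quad j : A * (v j ^+ 2 + v (j + 1) ^+ 2) = gamma * (v j * v (j + 1)).
  have := H j; rewrite -/A => Hj; apply/eqP; rewrite -subr_eq0; apply/eqP.
  transitivity (gamma / 2 * (v j - v (j + 1)) ^+ 2 - (v j ^+ 2 + v (j + 1) ^+
    2)).
    by rewrite /A; field.
  by rewrite Hj subrr.
have v0S j : v j = 0 -> v (j + 1) = 0.
  move=> vj; have := quad j; rewrite vj mul0r mulr0 expr0n add0r.
  by move/eqP; rewrite mulf_eq0 (negbTE A0) sqrf_eq0 => /eqP.
have v_neq0 j : v j != 0.
  apply/negP => /eqP vj; case/eqP: vi.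
  rewrite -(subrK j i) addrC.
  by elim/Zp_ind_succ: (i - j) => [|l IH]; rewrite ?addr0 // addrA; apply: v0S.
pose y := v 1 / v 0; have y0 : y != 0 by rewrite mulf_neq0 ?invr_eq0.
exists y => // j; split=> //.
(* Both (v j, v (j + 1)) and (v 0, v 1) solve the same quadratic equation;
   eliminating gamma leaves a product of the two possible proportionalities. *)
have : (v (j + 1) * v 0 - v j * v 1) * (v (j + 1) * v 1 - v j * v 0) = 0.
  apply: (mulfI A0); rewrite mulr0.
  transitivity (v 0 * v 1 * (A * (v j ^+ 2 + v (j + 1) ^+ 2))
    - v j * v (j + 1) * (A * (v 0 ^+ 2 + v (0 + 1) ^+ 2)));
      first by rewrite add0r; ring.
  by rewrite !quad add0r; ring.
move/eqP; rewrite mulf_eq0 !subr_eq0 => /orP[] /eqP E; [left | right].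
  by apply: (mulIf (v_neq0 0)); rewrite E /y; field.
by apply: (mulIf (v_neq0 0)); rewrite -E /y; field.
Qed.

(** When the absolute value of y is not 1, an increment determines its exponent,
    so that the exponents change by one at each step and form a closed walk. *)
Lemma geometric_arises (R : realType) (N : nat) (phi : 'Z_N -> R[i]) (c : R[i])
    (v : 'Z_N -> R) (y : R) :
  (2 <= N)%N -> c != 0 -> (forall j, c * incr phi j = (v j)%:C) ->
  y != 0 -> `|y| != 1 ->
  (forall j, v j != 0 /\ (v (j + 1) = y * v j \/ v j = y * v (j + 1))) ->
  exists n q, arises_up_to n q y phi.
Proof.
move=> N2 c0 incE y0 y1 vP; have v_neq0 j : v j != 0 by case: (vP j).
have [k vk] : {k : 'Z_N -> int & forall j, v j = v 0 * y ^ k j}.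
  apply: (@boolp.choice _ _ (fun j k => v j = v 0 * y ^ k)) => j.
  elim/Zp_ind_succ: j => [|j [k vk]]; first by exists 0; rewrite expr0z mulr1.
  case: (vP j) => _ [vE | vE].
    by exists (k + 1); rewrite vE vk expfzDr // expr1z mulrCA (mulrC y).
  exists (k - 1); apply: (mulfI y0); rewrite -vE vk expfzDr // exprN1; field.
  exact: y0.
have stepk j : k (j + 1) = k j + 1 \/ k j = k (j + 1) + 1.
  case: (vP j) => _; rewrite (vk j) (vk (j + 1)) => -[vE | vE]; [left | right];
  apply: (exprz_inj_norm y0 y1); apply: (mulfI (v_neq0 0));
  by rewrite vE expfzDr // expr1z mulrCA (mulrC y).
have [lo le_lo] : exists lo, forall j, k lo <= k j.
  case: (Order.TotalTheory.arg_minP (P := xpredT) (i0 := 0) k isT) => lo _ H.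
  by exists lo => j; apply: H.
have [hi le_hi] : exists hi, forall j, k j <= k hi.
  case: (Order.TotalTheory.arg_maxP (P := xpredT) (i0 := 0) k isT) => hi _ H.
  by exists hi => j; apply: H.
pose f (j : 'Z_N) : nat := absz (k j - k lo).
have fE j : (f j)%:Z = k j - k lo by rewrite gez0_abs // subr_ge0.
have f_lt j : (f j < (f hi).+1)%N by rewrite ltnS -lez_nat !fE lerB.
pose e (j : 'Z_N) : 'I_(f hi).+1 := Ordinal (f_lt j).
have we : walk (fun j => e j).
  move=> j /=; have := stepk j; have := fE j; have := fE (j + 1).
  by move: (f j) (f (j + 1)) (k j) (k (j + 1)) (k lo) => a b ka kb kl; lia.
have n2 : (2 <= (f hi).+1)%N.
  have := we 0 => /=; have := f_lt 0; have := f_lt (0 + 1).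
  by move: (f 0) (f (0 + 1)) (f hi) => a b d; lia.
pose d : R := (v 0 * y ^ k lo)^-1; pose psi j := c * d%:C * phi j + 0.
have d0 : d != 0 by rewrite invr_eq0 mulf_neq0 ?expfz_neq0.
have psiE : increments y e psi.
  move=> j; rewrite -/(incr psi j) incr_affine mulrAC incE -rmorphM; congr _%:C.
  rewrite vk /d /= -[y ^+ f j]/(y ^ (f j)) fE expfzDr // -invr_expz.
  by field; rewrite expfz_neq0 // v_neq0.
have elo : e lo = 0%N :> nat by rewrite /= /f subrr.
have [q qP _] := arises_of_walk N2 n2 we elo (erefl _ : e hi = _ :> nat) psiE.
exists (f hi).+1, q, (fun j => j), (c * d%:C), 0; split=> //.
  exact: dihedral_id.
by rewrite mulf_neq0 // fmorph_eq0.
Qed.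

(** The ratio y differs from 1, as otherwise all increments would be equal and
    nonzero, against their sum being zero. If y <> -1 then |y| <> 1. *)
Lemma qcs_arises (R : realType) (N : nat) (phi : 'Z_N -> R[i]) (gamma : R) :
  (2 <= N)%N -> qcs_eq gamma phi -> real_seq phi -> nonconstant phi ->
  gamma != 2 ->
  exists n q y, arises_up_to n q y phi /\ distinct_powers n y.
Proof.
move=> N2 qcs /real_seq_incr[c [v [c0 incE]]] nc g2.
have [i inci] := nonconstant_incr nc.
have vi : v i != 0.
  by rewrite -(inj_eq (@complexI R)) -incE mulf_neq0.
have H : qcs_eq gamma (fun j => c * phi j + 0) by apply/qcs_affine.
have {}H := (qcs_eq_real gamma (fun j => etrans (incr_affine phi c 0 j) (incE
  j))).1 H.
have [y y0 vP] := qcs_ratio g2 vi H.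
have sum_v : \sum_j v j = 0.
  apply: complexI; rewrite rmorph_sum rmorph0 /=.
  by under eq_bigr do rewrite -incE; rewrite -mulr_sumr sum_incr mulr0.
have y1 : y != 1.
  apply: contraNneq vi => yE; suff constv j : v j = v 0.
    move/eqP: sum_v; under eq_bigr do rewrite constv.
    by rewrite sumr_const -mulr_natl mulf_eq0 pnatr_eq0 card_ord /= (constv i).
  elim/Zp_ind_succ: j => // j <-.
  by case: (vP j) => _; rewrite yE !mul1r => -[].
have [yN1 | yN1] := eqVneq y (-1).
  have [|q qP] := @alternating_arises R N phi N2 nc.
    move=> j; apply: (mulfI c0); rewrite mulrN !incE -rmorphN; congr _%:C.
    by case: (vP j) => _; rewrite yN1 !mulN1r => -[// | ->]; rewrite opprK.
  by exists 2, q, (-1); rewrite distinct_powersN1.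
have ny1 : `|y| != 1.
  by rewrite -[1]normr1 eqr_norm2 negb_or y1.
have [n [q qP]] := geometric_arises N2 c0 incE y0 ny1 vP.
by exists n, q, y; split=> //; apply: distinct_powers_norm.
Qed.

(** * Uniqueness of the polynomial *)

Lemma coef_recip_poly (p : {poly int}) (k : nat) :
  (recip_poly p)`_k = if (k < size p)%N then p`_((size p).-1 - k) else 0.
Proof.
have -> : recip_poly p = \poly_(i < size p) p`_((size p).-1 - i).
  rewrite poly_def /recip_poly (reindex_inj rev_ord_inj) /=.
  apply: eq_bigr => i _; have := ltn_ord i.
  by case: (size p) i => // m i im; congr (_`_ _ *: 'X^_); lia.
by rewrite coef_poly.
Qed.

(** Replace the exponent e by n - 1 - e and divide the sequence by
    y^(n - 1). *)
Lemma reversed_arises (R : realType) (n N : nat) (q : {poly int}) (y : R)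
    (phi : 'Z_N -> R[i]) :
  (2 <= N)%N -> arises_up_to n q y phi ->
  exists2 q', arises_up_to n q' y^-1 phi &
    qcs_poly q' = recip_poly (qcs_poly q).
Proof.
move=> N2 [g [c [b [dg c0 [n2 qP _ py [e eP incE]]]]]].
have y0 : y != 0 by rewrite ltr0_neq0 // (qcs_root_lt0 n2 qP py).
have [_ we] := eP; pose e' j := rev_ord (e j).
have we' : walk (fun j => e' j).
  move=> j /=; have := we j; have := ltn_ord (e j); have := ltn_ord (e (j + 1)).
  by move: (nat_of_ord (e j)) (nat_of_ord (e (j + 1))) => k l; lia.
have [i ei] := allowed_attained n2 qP eP (ltnW n2).
have [j ej] : exists j, e j = n.-1 :> nat by apply: (allowed_attained n2 qP
  eP); lia.
have e'j : e' j = 0%N :> nat by rewrite /= ej; lia.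
have e'i : e' i = n.-1 :> nat by rewrite /= ei; lia.
pose d := (y ^- n.-1)%:C.
have d0 : d != 0 by rewrite fmorph_eq0 invr_eq0 expf_neq0.
have incE' : increments y^-1 e' (fun l => d * c * phi (g l) + d * b).
  move=> l; transitivity (d * (y ^+ e l)%:C); first by rewrite -incE; ring.
  rewrite -rmorphM; congr _%:C; rewrite exprVn /=.
  have -> : n.-1 = (n - (e l).+1 + e l)%N by have := ltn_ord (e l); lia.
  by rewrite exprD; field; rewrite !expf_neq0.
have [q' qP' eP'] := arises_of_walk N2 n2 we' e'j e'i incE'.
exists q'; first by exists g, (d * c), (d * b); rewrite mulf_neq0.
have [_ posq' _ _ _] := qP'.
apply/polyP => k; rewrite coef_recip_poly (size_qcs_poly n2 qP).
case: ltnP => [kn | nk];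
  last by rewrite nth_default // (size_qcs_poly n2 posq').
have rk : (n.-1 - k < n)%N by lia.
rewrite -(allowed_level (Ordinal kn) eP') -(allowed_level (Ordinal rk) eP).
congr Posz; apply: eq_bigr => l _; congr nat_of_bool.
by rewrite -!(inj_eq val_inj) /=; have := ltn_ord (e l); lia.
Qed.

(** All that matters about a realization of phi is how often each exponent
    occurs among the increments of phi, taken in any order. *)
Lemma arises_levels (R : realType) (n N : nat) (q : {poly int}) (y : R)
    (phi : 'Z_N -> R[i]) :
  arises_up_to n q y phi ->
  exists (f : 'Z_N -> nat) (d : R[i]),
    [/\ d != 0, forall j, incr phi j = d * (y ^+ f j)%:C &
        forall k, (\sum_j (f j == k))%N%:Z = (qcs_poly q)`_k].
Proof.
move=> [g [c [b [[s gE] c0 [n2 qP _ _ [e eP incE]]]]]].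
have countE k : (\sum_j (e j == k :> nat))%N%:Z = (qcs_poly q)`_k.
  have [kn | nk] := ltnP k n; first exact: (allowed_level (Ordinal kn) eP).
  rewrite nth_default ?(size_qcs_poly n2 qP) // big1 // => j _.
  by rewrite ltn_eqF // (leq_trans _ nk).
case: gE => gE.
  exists (fun j => e (j - s)), c^-1; split=> [|j|k]; first by rewrite invr_eq0.
    apply: (mulfI c0); rewrite mulVKf // -incE !gE /incr.
    have -> : s + (j - s + 1) = j + 1 by ring.
    by have -> : s + (j - s) = j by [ring]; ring.
  by rewrite -countE [in RHS](reindex_inj (addIr (- s))).
exists (fun j => e (s - 1 - j)), (- c^-1); split=> [|j|k].
- by rewrite oppr_eq0 invr_eq0.
- apply: (mulfI c0); rewrite mulNr mulrN mulVKf // -incE !gE /incr.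
  have -> : s - (s - 1 - j + 1) = j by ring.
  by have -> : s - (s - 1 - j) = j + 1 by [ring]; ring.
by rewrite -countE [in RHS](reindex_inj (subrI (s - 1))).
Qed.

(** Both families of exponents start at 0, so two realizations with the same
    ratio y cannot differ by a shift of the exponents. *)
Lemma arises_unique (R : realType) (n n' N : nat) (q q' : {poly int}) (y : R)
    (phi : 'Z_N -> R[i]) :
  `|y| != 1 -> arises_up_to n q y phi -> arises_up_to n' q' y phi ->
  qcs_poly q' = qcs_poly q.
Proof.
move=> y1 qP qP'.
have attained0 m (r : {poly int}) (f : 'Z_N -> nat) : arises_up_to m r y phi ->
    (forall k, (\sum_j (f j == k))%N%:Z = (qcs_poly r)`_k) -> exists j, f j =
      0%N.
  move=> [g [c [b [_ _ [m2 rP _ _ _]]]]] countE.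
  have := coef_qcs_poly_gt0 m2 rP (ltnW m2);
    rewrite -countE ltz_nat lt0n sum_nat_eq0.
  by case/forallPn => j; rewrite implyTb eqb0 negbK => /eqP; exists j.
have y0 : y != 0.
  by have [g [c [b [_ _ [n2 rP _ py _]]]]] := qP;
    rewrite ltr0_neq0 // (qcs_root_lt0 n2 rP py).
have [f [d [d0 incE countE]]] := arises_levels qP.
have [f' [d' [d'0 incE' countE']]] := arises_levels qP'.
have [i fi] := attained0 _ _ _ qP countE.
have [i' fi'] := attained0 _ _ _ qP' countE'.
(* The unknown factors d and d' disappear from the products of two
   increments. *)
have cross j l : (f j + f' l = f' j + f l)%N.
  apply: (expr_inj_norm y0 y1); apply: complexI => /=.
  apply: (mulfI d0); apply: (mulfI d'0); rewrite !exprD !rmorphM /=.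
  transitivity (incr phi j * incr phi l); first by rewrite {1}incE incE'; ring.
  by rewrite {1}incE' incE; ring.
have ff' j : f j = f' j.
  have := cross j i; have := cross i' i; move: (f j) (f' j) (f' i) fi fi'; lia.
by apply/polyP => k; rewrite -countE -countE'; under eq_bigr do rewrite -ff'.
Qed.

(** With two levels q is a constant, equal to half the length of the
    sequence. *)
Lemma arises_two_levels (R : realType) (N : nat) (q q' : {poly int}) (y y' : R)
    (phi : 'Z_N -> R[i]) :
  arises_up_to 2 q y phi -> arises_up_to 2 q' y' phi -> q' = q.
Proof.
have qE (r : {poly int}) (z : R) : arises_up_to 2 r z phi ->
    N%:Z = 2 * r`_0 /\ r = (r`_0)%:P.
  move=> [g [c [b [_ _ [_ [sr _] NE _ _]]]]]; split.
    by rewrite NE /qcs_order big_ord1.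
  by apply: size1_polyC; rewrite sr.
move=> /qE[N1 ->] /qE[N2 ->]; congr _%:P.
by apply: (@mulfI _ 2) => //; rewrite -N1 -N2.
Qed.

Lemma arises_up_to_bounds (R : realType) (n N : nat) (q : {poly int}) (y : R)
    (phi : 'Z_N -> R[i]) :
  arises_up_to n q y phi -> (2 <= n)%N /\ y < 0.
Proof.
move=> [g [c [b [_ _ [n2 qP _ py _]]]]].
by split=> //; apply: (qcs_root_lt0 n2 qP py).
Qed.

Lemma gamma_ofN1 (R : realType) : gamma_of (-1 : R) = 1.
Proof.
rewrite /gamma_of; have -> : 1 - (-1) = 2 :> R by ring.
by field.
Qed.

Lemma gamma_of_eq1 (R : realType) (y : R) : y < 0 -> 1 = gamma_of y <-> y = -1.
Proof.
move=> y0; split=> [g1 | ->]; last by rewrite gamma_ofN1.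
have [//|->] := gamma_of_eq y0 (ltrN10 R) (etrans (esym g1) (esym (gamma_ofN1
  R))).
by rewrite invrN1.
Qed.

(** Two realizations have the same gamma, so their ratios agree or are mutually
    inverse; in the second case the first realization is reversed before the
    comparison. At y = -1 distinctness of the powers forces two levels. *)
Lemma arises_up_to_recip (R : realType) (n N : nat) (q : {poly int}) (y gamma :
  R)
    (phi : 'Z_N -> R[i]) :
  (2 <= N)%N -> qcs_eq gamma phi -> arises_up_to n q y phi ->
  distinct_powers n y ->
  forall p' : {poly int},
    (exists (n' : nat) (q' : {poly int}) (y' : R),
       [/\ p' = qcs_poly q', arises_up_to n' q' y' phi &
           gamma != 1 \/ distinct_powers n' y']) <->
    (p' = qcs_poly q \/ p' = recip_poly (qcs_poly q)).
Proof.
move=> N2 qcs qP dy p'.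
have gE n' q' y' : arises_up_to n' q' y' phi -> gamma = gamma_of y'.
  by move=> qP'; apply/(arises_up_to_qcs gamma qP').
have [n2 y0] := arises_up_to_bounds qP.
have [q1 qP1 q1E] := reversed_arises N2 qP.
split=> [[n' [q' [y' [-> qP' gd]]]] | [->|->]]; last first.
- by exists n, q1, y^-1; split=> //; right; apply: distinct_powersV.
- by exists n, q, y; split=> //; right.
have [n'2 y'0] := arises_up_to_bounds qP'.
have gy : gamma_of y' = gamma_of y by rewrite -(gE _ _ _ qP) -(gE _ _ _ qP').
have [yN1 | yN1] := eqVneq y (-1).
  have y'N1 : y' = -1.
    by apply/(gamma_of_eq1 y'0); rewrite gy yN1 gamma_ofN1.
  case: gd => [|dy']; first by rewrite (gE _ _ _ qP) yN1 gamma_ofN1 eqxx.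
  move: dy dy'; rewrite yN1 y'N1 !distinct_powersN1 => n_le2 n'_le2.
  have nE : n = 2 by lia.
  have n'E : n' = 2 by lia.
  by left; congr qcs_poly; rewrite nE n'E in qP qP';
    apply: arises_two_levels qP qP'.
have ny1 := norm_neq1 y0 yN1.
case: (gamma_of_eq y'0 y0 gy) => y'E; rewrite y'E in qP'.
  by left; apply: arises_unique qP qP'.
right; rewrite -q1E; apply: arises_unique qP1 qP'.
by rewrite normfV invr_eq1.
Qed.

(** * The case gamma = 2 *)

Lemma qcs2P (R : realType) (N : nat) (phi : 'Z_N -> R[i]) :
  qcs_eq 2 phi <-> forall j, phi j = phi (j - 1) \/ phi j = phi (j + 1).
Proof.
have splitE (a b c : R[i]) :
    (2 / 2)%:C * (2 * a - b - c) ^+ 2 = (a - b) ^+ 2 + (a - c) ^+ 2 <->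
    a = b \/ a = c.
  rewrite divff ?pnatr_eq0 // rmorph1 mul1r; split=> [H | [-> | ->]];
    try by ring.
  have : 2 * ((a - b) * (a - c)) = 0.
    apply: (addIr ((a - b) ^+ 2 + (a - c) ^+ 2)).
    by rewrite add0r -[RHS]H; ring.
  by move/eqP; rewrite !mulf_eq0 pnatr_eq0 /= !subr_eq0 => /orP[] /eqP;
    [left | right].
by split=> H j; apply/splitE/H.
Qed.

(** Cutting the cycle just before each element of S: the segment containing j
    starts at the last element of S at or before j. Two adjacent positions are
    never both in S, so every segment has at least two elements. *)
Lemma segment_partition (T : Type) (N : nat) (S : pred 'Z_N) (phi : 'Z_N -> T) :
  (2 <= N)%N -> (exists s, S s) -> (forall j, S j -> ~~ S (j + 1)) ->
  (forall j, ~~ S (j + 1) -> phi (j + 1) = phi j) ->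
  exists2 P : {set {set 'Z_N}}, partition P [set: 'Z_N] &
    forall A, A \in P ->
      [/\ segment A, (2 <= #|A|)%N & {in A &, forall i j, phi i = phi j}].
Proof.
move=> N2 [s0 Ss0] sparse const.
have ex_back j : exists i : nat, S (j - i%:R).
  by exists (j - s0); rewrite natr_Zp opprB addrC subrK.
pose back j := ex_minn (ex_back j); pose start j := j - (back j)%:R.
have S_start j : S (start j) by rewrite /start /back; case: ex_minnP.
have back_min j i : S (j - i%:R) -> (back j <= i)%N.
  by move=> Sji; rewrite /back; case: ex_minnP => m _; apply.
have ex_len s : S s -> exists l, (0 < l)%N && S (s + l%:R).
  by move=> Ss; exists N; rewrite pchar_Zp // addr0 Ss (ltnW N2).
have startP s : S s -> exists2 l,
    [/\ (2 <= l)%N, (l <= N)%N & forall i, (0 < i < l)%N -> ~~ S (s + i%:R)] &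
    forall j, start j = s <-> exists2 i, (i < l)%N & j = s + i%:R.
  move=> Ss; case: (ex_minnP (ex_len s Ss)) => l /andP[l0 Sl] l_min.
  have notS i : (0 < i < l)%N -> ~~ S (s + i%:R).
    move=> /andP[i0 il]; apply/negP => Si.
    by have := l_min i; rewrite i0 Si => /(_ isT); rewrite leqNgt il.
  exists l.
    split=> //; last by apply: l_min; rewrite pchar_Zp // addr0 Ss (ltnW N2).
    rewrite ltn_neqAle l0 andbT; apply/eqP => l1; move: Sl.
    by rewrite -l1 (negbTE (sparse _ Ss)).
  move=> j; split=> [sE | [i il jE]].
    exists (back j); last by rewrite -sE subrK.
    rewrite ltnNge; apply/negP => lb.
    have := back_min j (back j - l)%N; rewrite natrB // opprB addrCA addrC.
    rewrite -/(start j) sE Sl => /(_ isT); lia.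
  have bi : (back j <= i)%N by apply: back_min; rewrite jE addrK.
  have [lt_bi | //] := ltnP (back j) i; last first.
    by move=> ib; have iE : back j = i by [lia]; rewrite /start iE jE addrK.
  have := notS (i - back j)%N; rewrite natrB // addrA -jE -/(start j) S_start.
  by move=> /(_ _)/negP H; exfalso; apply: H; lia.
exists (preim_partition start [set: 'Z_N]); first exact: preim_partitionP.
move=> A /imsetP[x _ AE].
have [l [l2 lN notS] blockE] := startP _ (S_start x);
  set s := start x in notS blockE.
have inA j : j \in A <-> exists2 i, (i < l)%N & j = s + i%:R.
  by rewrite AE !inE -blockE /=; split=> [/eqP <- | ->].
split.
- exists s, l; split=> //; apply/setP => j; apply/idP/imsetP.
    by move/inA => [i il ->]; exists (Ordinal il).
  by move=> [i _ ->]; apply/inA; exists i.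
- apply/card_gt1P; exists s, (s + 1); split.
  + by apply/inA; exists 0%N; rewrite ?addr0 //; lia.
  + by apply/inA; exists 1%N.
  + by rewrite -subr_eq0 opprD addNKr oppr_eq0 oner_eq0.
- suff toS j : j \in A -> phi j = phi s by move=> i j /toS-> /toS->.
  move=> /inA[i il ->]; elim: i il => [|i IH] il; first by rewrite addr0.
  rewrite -IH; last exact: ltnW.
  by rewrite -natr1 addrA const // -addrA natr1 notS.
Qed.

Lemma qcs2_segments (R : realType) (N : nat) (phi : 'Z_N -> R[i]) :
  (2 <= N)%N -> qcs_eq 2 phi <-> made_of_constant_segments phi.
Proof.
move=> N2; rewrite qcs2P; split=> [H | [P /and3P[/eqP covP _ _] PP] j].
  pose D := [pred j | phi j != phi (j - 1)].
  (* A constant sequence has no jump; the whole cycle is then cut at 0. *)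
  pose S := [pred j | D j || [forall k, ~~ D k] && (j == 0)].
  apply: (segment_partition (S := S)) => // [||j].
  - case: (boolP [exists k, D k]) => [/existsP[k Dk] | noD]; first by exists k;
    apply/orP; left.
    by exists 0; apply/orP; right; rewrite eqxx andbT -negb_exists.
  - move=> j /= Sj; rewrite addrK !negb_or negbK.
    case/orP: Sj => [Dj | /andP[noD /eqP->]].
      have [jE | jE] := H j; first by rewrite jE eqxx in Dj.
      rewrite jE eqxx /= negb_and; apply/orP; left; apply/forallPn; exists j.
      by rewrite /= negbK.
    have := forallP noD 1; rewrite /= !add0r subrr negbK => ->.
    by rewrite negb_and oner_eq0 orbT.
  - by rewrite /= addrK negb_or negbK => /andP[/eqP].
have : j \in cover P by rewrite covP in_setT.
case/bigcupP => A /PP[[s [l [_ AE]]] A2 constA] jA.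
have inA (i : nat) : (i < l)%N -> s + i%:R \in A.
  by move=> il; rewrite AE; apply/imsetP; exists (Ordinal il).
have l2 : (2 <= l)%N by rewrite (leq_trans A2) // AE (leq_trans (leq_imset_card
  _ _)) // card_ord.
have := jA; rewrite {1}AE => /imsetP[[[|i] il] _ jE]; [right | left];
  apply: constA => //.
  by rewrite jE addr0 (inA 1%N).
by rewrite jE -natr1 addrA addrK inA // ltnW.
Qed.

(** * The case gamma = 1 *)

Lemma qcs1P (R : realType) (N : nat) (phi : 'Z_N -> R[i]) :
  qcs_eq 1 phi <-> forall j, incr phi (j + 1) = - incr phi j.
Proof.
have squareE (u v : R[i]) :
    (1 / 2)%:C * (u - v) ^+ 2 = u ^+ 2 + v ^+ 2 <-> v = - u.
  rewrite rmorphM rmorph1 mul1r fmorphV rmorph_nat.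
  split=> [H | ->]; last by field.
  have : (u + v) ^+ 2 = 0.
    transitivity (2 * (u ^+ 2 + v ^+ 2) - (u - v) ^+ 2); first by ring.
    by rewrite -H; field.
  by move/eqP; rewrite sqrf_eq0 addrC addr_eq0 => /eqP.
by rewrite qcs_incrP; split=> H j; apply/squareE/H.
Qed.

Lemma odd_Zp_succ (N : nat) (j : 'Z_N) :
  (2 <= N)%N -> ~~ odd N -> odd (j + 1)%R = ~~ odd j.
Proof.
case: N j => [|[|M]] // j _ oddN.
by case: (ord_succ_cases j) => [[-> jE] | -> //];
  rewrite jE -[~~ odd M.+1]/(odd M.+2) (negbTE oddN).
Qed.

(** Alternating increments mean phi(j + 2) = phi(j), so phi depends only on the
    parity of j; on a cycle of odd length it would be constant. *)
Lemma qcs1_parity (R : realType) (N : nat) (phi : 'Z_N -> R[i]) :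
  (2 <= N)%N ->
  (qcs_eq 1 phi /\ nonconstant phi <->
   ~~ odd N /\ normalizes_to phi (fun j : 'Z_N => (odd j)%:R)).
Proof.
move=> N2; rewrite qcs1P;
  split=> [[alt [i [j neq]]] | [evenN [a [b [a0 phiE]]]]].
  have phi_SS k : phi (k + 1 + 1) = phi k.
    by have := alt k; rewrite /incr opprB => /subIr.
  have phi_nat m : phi m%:R = (if odd m then phi 1 else phi 0)
      /\ phi m.+1%:R = (if odd m then phi 0 else phi 1).
    elim: m => [//|m [IH1 IH2]]; rewrite IH2 /=; split; first by case: odd.
    by rewrite -natr1 -natr1 phi_SS IH1; case: odd.
  have phiE k : phi k = if odd k then phi 1 else phi 0.
    by rewrite -[in LHS](natr_Zp k) (phi_nat k).1.
  have phi10 : phi 1 != phi 0.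
    by apply/eqP => phi10; apply: neq; rewrite (phiE i) (phiE j) phi10 !if_same.
  split.
    apply: contra phi10 => oddN; have := (phi_nat N).1.
    by rewrite oddN pchar_Zp // => ->.
  have d0 : phi 1 - phi 0 != 0 by rewrite subr_eq0.
  exists (phi 1 - phi 0)^-1, (- ((phi 1 - phi 0)^-1 * phi 0)); rewrite invr_eq0.
  split=> //; left=> k; rewrite (phiE k) -mulrBr.
  by case: odd; [rewrite mulVf | rewrite subrr mulr0].
have [c [d [c0 {}phiE]]] : exists c d : R[i], c != 0 /\ forall j, phi j = c *
  (odd j)%:R + d.
  case: phiE => phiE.
    exists a^-1, (- (a^-1 * b)); rewrite invr_eq0; split=> // j.
    by rewrite phiE; field.
  exists (conjc a)^-1, (- ((conjc a)^-1 * conjc b)).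
  rewrite invr_eq0 fmorph_eq0; split=> // j.
  have -> : (odd j)%:R = conjc (odd j)%:R :> R[i] by rewrite rmorph_nat.
  rewrite phiE rmorphD rmorphM /= conjcK; field.
  by rewrite fmorph_eq0.
split=> [j|].
  rewrite /incr !phiE !odd_Zp_succ // negbK; case: odd => /=; ring.
exists 1, 0; rewrite !phiE; case: (N) N2 => [|[|M]] //= _;
  rewrite mulr0 mulr1 add0r.
by move/eqP; rewrite -subr_eq0 addrK (negbTE c0).
Qed.

(** * Construction, converse and special values *)

Theorem theorem1 (R : realType) :
  (* Construction *)
  (forall (n N : nat) (q : {poly int}) (y : R),
     (2 <= n)%N -> positive_coefs n q -> N%:Z = qcs_order n q ->
     root (map_poly intr (qcs_poly q)) y ->
     [/\ y < 0,
         (2 <= N)%N,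
         2 * (1 + y ^+ 2) / (1 - y) ^+ 2 < 2,
         (exists e : 'Z_N -> 'I_n, allowed_exponents q e) &
         forall e : 'Z_N -> 'I_n, allowed_exponents q e ->
           (forall x0 : R[i],
              exists! phi : 'Z_N -> R[i], phi 0 = x0 /\ increments y e phi) /\
           (forall phi : 'Z_N -> R[i], increments y e phi ->
              real_seq phi /\
              forall gamma : R,
                qcs_eq gamma phi <->
                gamma = 2 * (1 + y ^+ 2) / (1 - y) ^+ 2)]) /\
  (* Converse *)
  (forall (N : nat) (phi : 'Z_N -> R[i]) (gamma : R),
     (2 <= N)%N -> qcs_eq gamma phi -> real_seq phi -> nonconstant phi ->
     gamma != 2 ->
     exists (n : nat) (q : {poly int}) (y : R),
       [/\ arises_up_to n q y phi, distinct_powers n y &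
           forall p' : {poly int},
             (exists (n' : nat) (q' : {poly int}) (y' : R),
                [/\ p' = qcs_poly q', arises_up_to n' q' y' phi &
                    gamma != 1 \/ distinct_powers n' y']) <->
             (p' = qcs_poly q \/ p' = recip_poly (qcs_poly q))]) /\
  (* Special value gamma = 2 *)
  (forall (N : nat) (phi : 'Z_N -> R[i]),
     (2 <= N)%N ->
     (qcs_eq 2 phi <-> made_of_constant_segments phi)) /\
  (* Special value gamma = 1 *)
  (forall (N : nat) (phi : 'Z_N -> R[i]),
     (2 <= N)%N ->
     [/\ (qcs_eq 1 phi /\ nonconstant phi <->
          ~~ odd N /\ normalizes_to phi (fun j : 'Z_N => (odd j)%:R)),
         (qcs_eq 1 phi -> nonconstant phi ->
          exists (n : nat) (q : {poly int}), arises_up_to n q (-1 : R) phi) &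
         forall (n : nat) (q : {poly int}) (y : R),
           arises_up_to n q y phi -> (qcs_eq 1 phi <-> y = -1)]).
Proof.
split=> [n N q y n2 qP NE py|].
  have y0 := qcs_root_lt0 n2 qP py.
  have N2 : (2 <= N)%N.
    have : 0 < q`_0 by apply: qP.2; lia.
    have : q`_0 <= \sum_(k < n.-1) q`_k.
      have n1 : (0 < n.-1)%N by lia.
      rewrite (bigD1 (Ordinal n1)) //= lerDl sumr_ge0 // => k _.
      exact: coef_positive_coefs qP.
    by rewrite -lez_nat NE /qcs_order; lia.
  split=> //; [exact: gamma_of_lt2 | exact: exists_allowed NE |].
  move=> e eP; have [_ we] := eP; split=> [x0 | phi incE].
    apply: increments_exists.
    by rewrite (sum_allowed _ n2 qP eP); apply/rootP.
  by split=> [|gamma]; [apply: increments_real incE | apply: increments_qcs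
    incE].
split=> [N phi gamma N2 qcs real_phi nc g2|].
  have [n [q [y [qP dy]]]] := qcs_arises N2 qcs real_phi nc g2.
  by exists n, q, y; split=> //; apply: arises_up_to_recip qcs qP dy.
split=> N phi N2; first exact: qcs2_segments.
split=> [||n q y qP].
- exact: qcs1_parity.
- by move=> /qcs1P alt nc; exists 2; apply: alternating_arises.
- have [_ y0] := arises_up_to_bounds qP.
  by rewrite (arises_up_to_qcs _ qP) gamma_of_eq1.
Qed.
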